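(* Let $\xi,\Delta:\{t_0,t_0+1,\dots\}\to\mathbb R^+$ be such that $\Delta$ and $t\mapsto\xi_t\Delta_t$ are non-increasing and $\xi$ is non-decreasing. Let $F=\{\{f_{t,i}\}_{i=1}^{\ell_t}\}_{t\ge t_0}$ be a stream of real-valued queries with sensitivity $\Delta_{f_{t,i}}\le\Delta_t$ for all $(t,i)$, and let $T\in\mathbb R$. Then for any output $a$ in the range of NATG that halts at time $t'$ and any neighboring database streams $D,D'$ of starting size $t_0$, $$\Pr[\mathrm{NATG}(D,F,T,\xi)=a]\le\exp\!\Big(\xi_{t_0}\Delta_{t_0}+\frac{\xi_{t'}\Delta_{t'}}{8}\Big)\Pr[\mathrm{NATG}(D',F,T,\xi)=a],$$ where for the real-valued final output ''probability'' is understood as density.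
   Context: A database stream $D=\{D_t\}_{t\ge t_0}$ consists of databases $D_t$ of size $t$ over a finite universe, with $D_{t+1}$ obtained from $D_t$ by adding one entry. Same-size databases are neighboring if they differ in one entry; streams $D,D'$ are neighboring if for some $t\ge t_0$, $D_\tau=D'_\tau$ for $t_0\le\tau<t$ and $D_\tau,D'_\tau$ are neighboring for all $\tau\ge t$. Query $f_{t,i}$ is a real-valued function on databases, arriving when the database has size $t$; its sensitivity $\Delta_{f_{t,i}}$ is $\max|f_{t,i}(E)-f_{t,i}(E')|$ over neighboring databases $E,E'$ of size $t$. $\mathrm{Lap}(b)$ has density $\frac1{2b}e^{-|z|/b}$. $\mathrm{NATG}(D,F,T,\xi)$: draw $\eta\sim\mathrm{Lap}(2)$ once. For each incoming query $f_{t,i}$: draw fresh $\nu_{t,i}\sim\mathrm{Lap}(4/\xi_t)$; if $f_{t,i}(D_t)+\nu_{t,i}\ge T+\eta/\xi_t$, output $f_{t,i}(D_t)+Z$ with fresh $Z\sim\mathrm{Lap}(8/\xi_t)$ and halt; otherwise output $\bot$. *)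

(* Defs.v *)
From HB Require Import structures.
From mathcomp Require Import all_boot all_order all_algebra.
From mathcomp Require Import all_classical all_reals all_analysis.
Set Implicit Arguments.
Unset Strict Implicit.
Unset Printing Implicit Defensive.
Import Order.TTheory GRing.Theory Num.Theory.
Import numFieldNormedType.Exports.
Local Open Scope classical_set_scope.
Local Open Scope ring_scope.

Definition neighboring (U : finType) (t : nat) (E E' : t.-tuple U) : bool :=
  #|[set j : 'I_t | tnth E j != tnth E' j]%SET| == 1%N.

(* [perm_eq] imposes no order of arrival on the entries: append-only tuples and
   multisets (with permutation-invariant queries) are both instances. *)
Definition database_stream (U : finType) (t0 : nat)
    (D : forall t : nat, t.-tuple U) : Prop :=
  forall t : nat, (t0 <= t)%N -> exists u : U, perm_eq (D t.+1) (u :: D t).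

Definition neighboring_streams (U : finType) (t0 : nat)
    (D D' : forall t : nat, t.-tuple U) : Prop :=
  exists t : nat, [/\ (t0 <= t)%N,
    forall s : nat, (t0 <= s < t)%N -> D s = D' s &
    forall s : nat, (t <= s)%N -> neighboring (D s) (D' s)].

Definition sensitivity (R : realType) (U : finType) (t : nat)
    (g : t.-tuple U -> R) : R :=
  \big[Num.max/0]_(p : t.-tuple U * t.-tuple U | neighboring p.1 p.2)
    `|g p.1 - g p.2|.

Definition laplace_pdf (R : realType) (b z : R) : R :=
  (2 * b)^-1 * expR (- `|z| / b).

Definition laplace_distributed (R : realType) (d : measure_display)
    (Omega : measurableType d) (P : probability Omega R)
    (X : {RV P >-> R}) (b : R) : Prop :=
  forall A : set R, measurable A ->
    P (X @^-1` A) = (\int[lebesgue_measure]_(z in A) (laplace_pdf b z)%:E)%E.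

Definition mutually_independent (R : realType) (d : measure_display)
    (Omega : measurableType d) (P : probability Omega R)
    (I : Type) (X : I -> {RV P >-> R}) : Prop :=
  forall (n : nat) (g : 'I_n -> I), injective g ->
  forall A : 'I_n -> set R, (forall k : 'I_n, measurable (A k)) ->
    P (\bigcap_(k in [set: 'I_n]) (X (g k) @^-1` A k)) =
    (\prod_(k < n) P (X (g k) @^-1` A k))%E.

(* Names of the random draws eta, nu_{t,i} and Z_{t,i}. *)
Inductive noise_index : Type :=
  | Eta
  | Nu of nat & nat
  | Zed of nat & nat.

(* A draw Z_{t,i} is provided for every query, but only the one at the halting
   query is ever used. The queries at time t are numbered 0, ..., ell t - 1. *)
Definition natg_noise (R : realType) (d : measure_display)
    (Omega : measurableType d) (P : probability Omega R)
    (t0 : nat) (ell : nat -> nat) (xi : nat -> R)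
    (noise : noise_index -> {RV P >-> R}) : Prop :=
  [/\ mutually_independent noise,
      laplace_distributed (noise Eta) 2,
      forall t i : nat, (t0 <= t)%N -> (i < ell t)%N ->
        laplace_distributed (noise (Nu t i)) (4 / xi t) &
      forall t i : nat, (t0 <= t)%N -> (i < ell t)%N ->
        laplace_distributed (noise (Zed t i)) (8 / xi t)].

Definition queries_upto (t0 : nat) (ell : nat -> nat) (t : nat) :
    seq (nat * nat) :=
  [seq (s, i) | s <- index_iota t0 t.+1, i <- iota 0 (ell s)].

(* Answers to a list of incoming queries for given values [z] of the noise;
   [None] stands for the answer "bottom". The list of answers is cut short at
   the halting query. *)
Fixpoint natg_run (R : realType) (U : finType) (D : forall t : nat, t.-tuple U)
    (f : forall t : nat, nat -> t.-tuple U -> R) (T : R) (xi : nat -> R)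
    (z : noise_index -> R) (qs : seq (nat * nat)) : seq (option R) :=
  if qs is (t, i) :: qs' then
    if T + z Eta / xi t <= f t i (D t) + z (Nu t i)
    then [:: Some (f t i (D t) + z (Zed t i))]
    else None :: natg_run D f T xi z qs'
  else [::].

(* The output that answers "bottom" to all queries before the i-th query of
   time t, and halts at that query with the value v. *)
Definition halting_output (R : realType) (t0 : nat) (ell : nat -> nat)
    (t i : nat) (v : R) : seq (option R) :=
  rcons (nseq (\sum_(t0 <= s < t) ell s + i) None) (Some v).

(* Once NATG has halted it outputs nothing more, so an output that halts at time
   t is the whole output iff it is the output on the queries up to time t. *)
Definition natg_halts_in (R : realType) (U : finType) (d : measure_display)
    (Omega : measurableType d) (P : probability Omega R)
    (t0 : nat) (ell : nat -> nat) (D : forall t : nat, t.-tuple U)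
    (f : forall t : nat, nat -> t.-tuple U -> R) (T : R) (xi : nat -> R)
    (noise : noise_index -> {RV P >-> R})
    (t i : nat) (B : set R) : set Omega :=
  [set w | exists2 v : R, B v &
     natg_run D f T xi (fun k => noise k w) (queries_upto t0 ell t) =
     halting_output t0 ell t i v].

(* p v is the density of the output [halting_output t0 ell t i v]. Continuity
   makes p unique, hence its pointwise values meaningful. *)
Definition natg_density (R : realType) (U : finType) (d : measure_display)
    (Omega : measurableType d) (P : probability Omega R)
    (t0 : nat) (ell : nat -> nat) (D : forall t : nat, t.-tuple U)
    (f : forall t : nat, nat -> t.-tuple U -> R) (T : R) (xi : nat -> R)
    (noise : noise_index -> {RV P >-> R})
    (t i : nat) (p : R -> R) : Prop :=
  [/\ continuous p,
      forall v : R, 0 <= p v &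
      forall B : set R, measurable B ->
        P (natg_halts_in t0 ell D f T xi noise t i B) =
        (\int[lebesgue_measure]_(v in B) (p v)%:E)%E].

(* Main.v *)
Require Import Defs.
From HB Require Import structures.
From mathcomp Require Import all_boot all_order all_algebra.
From mathcomp Require Import all_classical all_reals all_analysis.
From mathcomp Require Import measurable_realfun ring lra.
Import Order.TTheory GRing.Theory Num.Theory.
Import numFieldNormedType.Exports.
Local Open Scope classical_set_scope.
Local Open Scope ring_scope.

Set Implicit Arguments.
Unset Strict Implicit.
Unset Printing Implicit Defensive.

(** Let [H] be the event that every query before (t', i') is answered "bottom"
    and the query (t', i') is above the threshold. It only involves eta and the
    nu's, so it is independent of Z, and the density of the output is
    [P(H)] times the Laplace density of scale 8 / xi_{t'} translated by
    f_{t',i'}(D_{t'}). Changing D to D' costs the factor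
    exp(xi_{t'} Delta_{t'} / 8) in the latter.

    For [P(H)], put c = xi_{t0} Delta_{t0}, which bounds xi_s Delta_s for every
    s. Replacing eta by eta + c raises each threshold T + eta / xi_s by at least
    Delta_s, and replacing nu_{t',i'} by nu_{t',i'} + 2 c / xi_{t'} keeps the
    last query above its threshold; each of the two translations costs a factor
    exp(c / 2). To use only independence on rectangles, the line of eta is cut
    into cells of length h, on which the event is compared with rectangles at
    the price of a factor exp(h), and h tends to 0. *)

(** * Translations of Lebesgue measure and of Laplace densities *)

(** The pushforward gives each interval []x, y]] its length, which characterizes Lebesgue
    measure. *)
Lemma lebesgue_measure_preimage_addr (R : realType) (a : R) (A : set R) :
  measurable A ->
  pushforward lebesgue_measure
    ((fun x => x + a) : measurableTypeR R -> measurableTypeR R) A =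
  lebesgue_measure A.
Proof.
move=> mA.
pose S (x : measurableTypeR R) : measurableTypeR R := x + a.
have mS : measurable_fun setT S by exact: measurable_funD.
apply/esym/lebesgue_measure_unique => //= _ [[x y]] _ <-.
rewrite /pushforward/=.
rewrite (_ : _ @^-1` _ = `]x - a, y - a]%classic); last first.
  by apply/seteqP; split => z /=; rewrite !in_itv/=; lra.
rewrite !lebesgue_measure_itv/= !lte_fin ltrD2r.
by case: ifP => // _; rewrite -!EFinB; congr EFin; ring.
Qed.

Lemma ge0_integral_preimage_addr (R : realType) (a : R) (A : set R)
    (g : R -> \bar R) :
  measurable A -> measurable_fun [set: R] g -> (forall x, 0 <= g x)%E ->
  (\int[lebesgue_measure]_(x in (fun x => x + a)%R @^-1` A) g (x + a)%R =
   \int[lebesgue_measure]_(x in A) g x)%E.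
Proof.
move=> mA mg g0.
pose S (x : measurableTypeR R) : measurableTypeR R := x + a.
have mS : measurable_fun setT S by exact: measurable_funD.
rewrite -[LHS](@ge0_integral_pushforward _ _ _ _ _ S mS _ A g)//; last first.
  exact: measurable_funTS.
by apply: eq_measure_integral => //= B mB _; exact: lebesgue_measure_preimage_addr.
Qed.

Lemma laplace_pdf_ge0 (R : realType) (b z : R) : 0 < b -> 0 <= laplace_pdf b z.
Proof. by move=> b0; rewrite mulr_ge0 ?expR_ge0// invr_ge0 mulr_ge0// ltW. Qed.

Lemma continuous_laplace_pdf (R : realType) (b : R) :
  continuous (laplace_pdf b).
Proof.
move=> z; apply: cvgM; first exact: cvg_cst.
apply: (continuous_comp (f := fun x : R => - `|x| / b)); last first.
  exact: continuous_expR.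
by apply: cvgM; [apply: cvgN; exact: norm_continuous|exact: cvg_cst].
Qed.

Lemma measurable_laplace_pdf (R : realType) (b : R) :
  measurable_fun [set: R] (laplace_pdf b).
Proof. by apply: continuous_measurable_fun; exact: continuous_laplace_pdf. Qed.

Lemma laplace_pdf_shift_le (R : realType) (b a x y : R) : 0 < b ->
  `|x - y| <= a -> laplace_pdf b x <= expR (a / b) * laplace_pdf b y.
Proof.
move=> b0 xya; rewrite /laplace_pdf mulrCA -expRD.
rewrite ler_pM2l ?invr_gt0 ?mulr_gt0// ler_expR -mulrDl.
rewrite ler_pM2r ?invr_gt0// lerNl opprB lerBlDr addrC.
by have := ler_normD (y - x) x; rewrite subrK distrC => /le_trans->//; rewrite lerD2r.
Qed.

(** The price of moving the noise by [a]: a change of variable puts both integrals over the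
    translated set, where the densities are compared pointwise by [laplace_pdf_shift_le]. *)
Lemma laplace_shift_le (R : realType) (d : measure_display)
    (Omega : measurableType d) (P : probability Omega R) (X : {RV P >-> R})
    (b a : R) (A : set R) : laplace_distributed X b -> 0 < b -> 0 <= a ->
  measurable A ->
  (P (X @^-1` A) <=
   (expR (a / b))%:E * P (X @^-1` ((fun x => x - a)%R @^-1` A)))%E.
Proof.
move=> LX b0 a0 mA.
have mS c : measurable_fun [set: R] (fun x : R => x + c) by exact: measurable_funD.
have mA' : measurable ((fun x : R => x - a) @^-1` A).
  by rewrite -[X in measurable X]setTI; exact: mS.
rewrite (LX _ mA) (LX _ mA').
have mL (B : set R) : measurable_fun B (fun x => (laplace_pdf b x)%:E).
  apply/measurable_EFinP; apply: measurable_funTS.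
  exact: measurable_laplace_pdf.
rewrite -ge0_integralZl//; first last.
- by move=> x _; rewrite lee_fin laplace_pdf_ge0.
- exact: mL.
rewrite -[leLHS](@ge0_integral_preimage_addr _ (- a) A
  (fun x => (laplace_pdf b x)%:E))//; last first.
  by move=> x; rewrite lee_fin laplace_pdf_ge0.
apply: ge0_le_integral => //.
- by move=> x _; rewrite lee_fin laplace_pdf_ge0.
- apply/measurable_EFinP; apply: measurable_funTS.
  by apply: measurableT_comp; [exact: measurable_laplace_pdf|exact: mS].
- by apply: measurable_funeM; exact: mL.
- move=> x _; rewrite -EFinM lee_fin laplace_pdf_shift_le//.
  by rewrite addrAC subrr add0r normrN ger0_norm.
Qed.

(** * Independence on cylinders *)

(** The family [A] is total although only the coordinates in [s] are constrained, so that it can be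
    intersected with another family or altered at one index. *)
Definition cylinder {R : realType} {d : measure_display}
    {Omega : measurableType d} {P : probability Omega R} {I : eqType}
    (X : I -> {RV P >-> R}) (s : seq I) (A : I -> set R) : set Omega :=
  [set w | {in s, forall k, A k (X k w)}].

Lemma cylinder_cons (R : realType) (d : measure_display)
    (Omega : measurableType d) (P : probability Omega R) (I : eqType)
    (X : I -> {RV P >-> R}) (i : I) (s : seq I) (A : I -> set R) :
  cylinder X (i :: s) A = X i @^-1` A i `&` cylinder X s A.
Proof.
apply/seteqP; split => [w Aw|w [Ai Aw] k].
  by split => [|k ks]; apply: Aw; rewrite inE ?eqxx// ks orbT.
by rewrite inE => /predU1P[->//|]; exact: Aw.
Qed.

Lemma measurable_cylinder (R : realType) (d : measure_display)
    (Omega : measurableType d) (P : probability Omega R) (I : eqType)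
    (X : I -> {RV P >-> R}) (s : seq I) (A : I -> set R) :
  {in s, forall k, measurable (A k)} -> measurable (cylinder X s A).
Proof.
elim: s => [|i s IHs] mA.
  by rewrite (_ : cylinder _ _ _ = setT)//; apply/seteqP; split.
rewrite cylinder_cons; apply: measurableI.
  by apply: measurable_funPTI; apply: mA; rewrite inE eqxx.
by apply: IHs => k ks; apply: mA; rewrite inE ks orbT.
Qed.

(** A duplicate-free list is an injective enumeration of its elements by ['I_(size s)], the form in
    which independence is stated. *)
Lemma mutually_independent_cylinder (R : realType) (d : measure_display)
    (Omega : measurableType d) (P : probability Omega R) (I : eqType)
    (X : I -> {RV P >-> R}) (s : seq I) (A : I -> set R) :
  mutually_independent X -> uniq s -> {in s, forall k, measurable (A k)} ->
  P (cylinder X s A) = (\prod_(k <- s) P (X k @^-1` A k))%E.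
Proof.
move=> indX us mA.
have ms (k : 'I_(size s)) : tnth (in_tuple s) k \in s by exact: mem_tnth.
rewrite (big_tnth _ _ s) -(indX _ (tnth (in_tuple s)))//; first last.
- by move=> k; exact: mA.
- exact/tuple_uniqP.
congr (P _); apply/seteqP; split => [w Aw k _|w Aw k].
  exact: Aw.
by move=> /seq_tnthP[j ->]; exact: Aw.
Qed.

(* A pi-lambda argument over the cylinders of [s]. *)
Lemma mutually_independent_sigma (R : realType) (d : measure_display)
    (Omega : measurableType d) (P : probability Omega R) (I : eqType)
    (X : I -> {RV P >-> R}) (s : seq I) (j : I) (B : set R) (E : set Omega) :
  mutually_independent X -> uniq (j :: s) -> measurable B ->
  <<s [set cylinder X s A | A in [set A | forall k, measurable (A k)]] >> E ->
  P (E `&` X j @^-1` B) = (P E * P (X j @^-1` B))%E.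
Proof.
move=> indX /=/andP[js us] mB GE.
have mXB : measurable (X j @^-1` B) by exact: measurable_funPTI.
have fXB : P (X j @^-1` B) \is a fin_num by exact: fin_num_measure.
(* Both sides are finite measures in [E]: [m1] restricts [P] to the event on [X j], and [m2] scales
   [P] by the probability of that event. *)
pose b : {nonneg R} := NngNum (fine_ge0 (measure_ge0 P (X j @^-1` B))).
pose m1 : {measure set Omega -> \bar R} := mrestr P mXB.
pose m2 : {measure set Omega -> \bar R} := mscale b P.
have -> : (P E * P (X j @^-1` B))%E = m2 E.
  by rewrite /m2 /= /mscale/= fineK// muleC.
apply: (@g_sigma_algebra_measure_unique _ _ _ _ _ (fun=> setT) _ _ m1 m2) GE.
- by move=> _ [A mA <-]; exact: measurable_cylinder.
- move=> _; exists (fun=> setT) => //.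
  by apply/seteqP; split.
- by rewrite bigcup_const//; exists 0%N.
- move=> _ _ [A mA <-] [A' mA' <-]; exists (fun k => A k `&` A' k).
    by move=> k; exact: measurableI.
  apply/seteqP; split => [w AA'|w [Aw A'w] k ks].
    by split=> k /AA'[].
  by split; [exact: Aw|exact: A'w].
- move=> _ [A mA <-].
  (* Since [j] is not in [s], overriding [A] at [j] leaves the cylinder of [s] unchanged and turns
     the intersection into a cylinder of [j :: s]. *)
  pose A' k := if k == j then B else A k.
  have A'E k : k \in s -> A' k = A k.
    by move=> ks; rewrite /A'; case: eqVneq => // kj; rewrite -kj ks in js.
  have cE : cylinder X s A = cylinder X s A'.
    by apply/seteqP; split => w Aw k ks; have := Aw _ ks; rewrite A'E.
  have -> : m1 (cylinder X s A) = P (cylinder X (j :: s) A').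
    by rewrite cylinder_cons {1}/A' eqxx setIC cE.
  rewrite mutually_independent_cylinder//=; last 2 first.
  - by rewrite js.
  - by move=> k _; rewrite /A'; case: ifP.
  rewrite big_cons {1}/A' eqxx /m2 /mscale/= fineK//.
  rewrite cE mutually_independent_cylinder// => k ks.
  by rewrite A'E.
- move=> _; change (P (setT `&` X j @^-1` B) < +oo)%E.
  by rewrite setTI ltey_eq fXB.
Qed.

(** Classical equality test, giving lists of draws the membership predicate that [cylinder] uses. *)
HB.instance Definition _ := gen_eqMixin noise_index.

(** * Countable partitions and the limit of small cells *)

Lemma measure_partition_nat (R : realType) (d : measure_display)
    (Omega : measurableType d) (P : {measure set Omega -> \bar R})
    (N : Omega -> nat) (A : set Omega) :
  (forall n, measurable (A `&` N @^-1` [set n])) ->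
  P A = (\sum_(n <oo) P (A `&` N @^-1` [set n]))%E.
Proof.
move=> mAN; rewrite -measure_semi_bigcup//.
- by rewrite -setI_bigcupr -preimage_bigcup; congr (P _);
    apply/seteqP; split => [w Aw|w []//]; split=> //; exists (N w).
- exact: trivIset_preimage1_in.
- exact: bigcupT_measurable.
Qed.

(** The two events are cut by different labellings, so that a cell of eta can be compared with a
    translated cell. *)
Lemma le_measure_partition_nat (R : realType) (d : measure_display)
    (Omega : measurableType d) (P : {measure set Omega -> \bar R})
    (N M : Omega -> nat) (A B : set Omega) (C : R) :
  (forall n, measurable (A `&` N @^-1` [set n])) ->
  (forall n, measurable (B `&` M @^-1` [set n])) ->
  (forall n, P (A `&` N @^-1` [set n]) <= C%:E * P (B `&` M @^-1` [set n]))%E ->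
  (P A <= C%:E * P B)%E.
Proof.
move=> mA mB AB.
rewrite (measure_partition_nat P mA) (measure_partition_nat P mB).
by rewrite -nneseriesZl//; exact: lee_nneseries.
Qed.

(** Lets the cell length tend to 0. If the conclusion failed with [y > 0], taking for [h] half the
    logarithm of [x / (expR c * y)] would contradict the hypothesis; for [y = 0] the value [h = 1]
    suffices. *)
Lemma le_expR_gt0P (R : realType) (c x y : R) : 0 <= y ->
  (forall h, 0 < h -> x <= expR (c + h) * y) -> x <= expR c * y.
Proof.
move=> y0 xy; rewrite leNgt; apply/negP => yx.
have x0 : 0 < x by rewrite (le_lt_trans _ yx)// mulr_ge0// expR_ge0.
move: y0; rewrite le_eqVlt => /predU1P[y0|y0].
  by have := xy _ ltr01; rewrite -y0 mulr0 leNgt x0.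
have ey0 : 0 < expR c * y by rewrite mulr_gt0// expR_gt0.
have r1 : 1 < x / (expR c * y) by rewrite ltr_pdivlMr// mul1r.
have l0 : 0 < ln (x / (expR c * y)) by rewrite ln_gt0.
have h0 : 0 < ln (x / (expR c * y)) / 2 by rewrite divr_gt0.
have := xy _ h0; rewrite expRD mulrAC -ler_pdivrMl// mulrC.
rewrite -[leLHS]lnK ?posrE ?divr_gt0// ler_expR; lra.
Qed.

(** * The halting event and the cost of changing the answers *)

(** The databases enter only through the answers [g]. The draws are plain functions, so that the
    same set can be considered over another sigma-algebra. *)
Definition halting_event {R : realType} {d : measure_display}
    {Omega : measurableType d} (X : noise_index -> Omega -> R) (T : R)
    (xi : nat -> R) (pre : seq (nat * nat)) (q : nat * nat)
    (g : nat * nat -> R) : set Omega :=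
  [set w | {in pre, forall r, g r + X (Nu r.1 r.2) w < T + X Eta w / xi r.1} /\
           T + X Eta w / xi q.1 <= g q + X (Nu q.1 q.2) w].

(** The draws that determine [halting_event]; no [Zed] is among them, whence the independence from
    the noise of the released value. *)
Definition used_noise (pre : seq (nat * nat)) (q : nat * nat) :
    seq noise_index :=
  Eta :: [seq Nu r.1 r.2 | r <- q :: pre].

Lemma used_noise_uniq (pre : seq (nat * nat)) (q : nat * nat) :
  uniq (q :: pre) -> uniq (used_noise pre q).
Proof.
move=> uq; rewrite cons_uniq map_inj_uniq ?uq ?andbT; last first.
  by move=> [a b] [a' b'] /= [-> ->].
by apply/negP => /mapP[].
Qed.

Lemma measurable_halting_event (R : realType) (d : measure_display)
    (Omega : measurableType d) (X : noise_index -> Omega -> R) (T : R)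
    (xi : nat -> R) (pre : seq (nat * nat)) (q : nat * nat)
    (g : nat * nat -> R) :
  {in used_noise pre q, forall k, measurable_fun [set: Omega] (X k)} ->
  measurable (halting_event X T xi pre q g).
Proof.
move=> mX.
have mE s : measurable_fun setT (fun w => T + X Eta w / xi s).
  apply: measurable_funD => //; apply: measurable_funM => //.
  by apply: mX; rewrite inE eqxx.
have mN r : r \in q :: pre ->
    measurable_fun setT (fun w => g r + X (Nu r.1 r.2) w).
  move=> rq; apply: measurable_funD => //; apply: mX.
  by rewrite inE (map_f (fun r => Nu r.1 r.2)) ?orbT.
have mset (b : Omega -> bool) : measurable_fun setT b -> measurable [set w | b w].
  by move=> mb; rewrite -[X in measurable X]setTI -preimage_true; exact: mb.
rewrite /halting_event; apply: (@measurableI _ _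
  [set w | {in pre, forall r, g r + X (Nu r.1 r.2) w < T + X Eta w / xi r.1}]).
  have mP : {in pre, forall r, r \in q :: pre}.
    by move=> r rp; rewrite inE rp orbT.
  elim: pre mP {mX} mN => [|r s IHs] mP mN.
    by rewrite (_ : [set w | _] = setT)//; apply/seteqP; split.
  rewrite (_ : [set w | _] =
     [set w | g r + X (Nu r.1 r.2) w < T + X Eta w / xi r.1] `&`
     [set w | {in s, forall r, g r + X (Nu r.1 r.2) w < T + X Eta w / xi r.1}]).
    apply: measurableI; last first.
      apply: IHs => k ks; first by rewrite inE ks orbT.
      apply: mN; move: ks; rewrite !inE => /predU1P[->|->]; by rewrite ?eqxx ?orbT.
    apply: mset; apply: measurable_fun_ltr => //; apply: mN.
    by rewrite !inE eqxx orbT.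
  apply/seteqP; split => [w Hw|w [Hr Hw] k].
    by split => [|k ks]; apply: Hw; rewrite inE ?eqxx ?ks ?orbT.
  by rewrite inE => /predU1P[->//|]; exact: Hw.
by apply: mset; apply: measurable_fun_ler => //; apply: mN; rewrite inE eqxx.
Qed.

(* On the cell [a <= eta < a + h] the event for [g] is contained in a cylinder;
   moving eta by [c + h] and the noise of the halting query by [2 (c + h) / xi]
   sends this cylinder into the event for [g']. *)
Lemma halting_event_cell_le (R : realType) (d : measure_display)
    (Omega : measurableType d) (P : probability Omega R)
    (X : noise_index -> {RV P >-> R}) (T : R) (xi : nat -> R)
    (pre : seq (nat * nat)) (q : nat * nat) (g g' : nat * nat -> R)
    (c h a : R) :
  mutually_independent X -> laplace_distributed (X Eta) 2 ->
  laplace_distributed (X (Nu q.1 q.2)) (4 / xi q.1) ->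
  uniq (q :: pre) -> {in q :: pre, forall r, 0 < xi r.1} ->
  {in q :: pre, forall r, `|g r - g' r| <= c / xi r.1} ->
  0 <= c -> 0 <= h ->
  (P (halting_event X T xi pre q g `&` [set w | a <= X Eta w < a + h]%R) <=
   (expR (c + h))%:E *
   P (halting_event X T xi pre q g' `&`
      [set w | a <= X Eta w - (c + h) < a + h]%R))%E.
Proof.
move=> indX LE LN uq xi0 gg' c0 h0.
have xq0 : 0 < xi q.1 by apply: xi0; rewrite inE eqxx.
(* For eta in the cell [IE], halting at [q] forces its noise above the lowest threshold of the cell
   ([IN]), and a bottom answer at [r] forces its noise below the highest one ([I0 r]). *)
pose IE : set R := `[a, a + h[%classic.
pose IN : set R := `[T + a / xi q.1 - g q, +oo[%classic.
pose I0 (r : nat * nat) : set R := `]-oo, T + (a + h) / xi r.1 - g r[%classic.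
(* The translated eta stays below [a + c + 2 h] and the answer to [q] drops by at most [c / xi q.1];
   together the last noise must rise by [(c + 2 h + c) / xi q.1]. *)
pose b := 2 * (c + h) / xi q.1.
(* The sides for eta and the last noise are parameters, so that the original and the translated
   cylinders share the sides [I0]. The value [setT] is a default. *)
pose A (JE JN : set R) k : set R :=
  match k with
  | Eta => JE
  | Nu t i => if (t, i) == q then JN else I0 (t, i)
  | Zed _ _ => setT
  end.
have mA JE JN k : measurable JE -> measurable JN -> measurable (A JE JN k).
  move=> mJE mJN; case: k => [|t i|t i] /=; [exact: mJE| |exact: measurableT].
  by case: ifP => _; [exact: mJN|exact: measurable_itv].
have ANu JE JN r : r \in pre -> A JE JN (Nu r.1 r.2) = I0 r.
  move=> rp; rewrite /A -surjective_pairing; case: eqVneq => // rq.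
  by move: uq; rewrite /= -rq rp.
have mS s : measurable_fun [set: R] (fun x : R => x - s) by exact: measurable_funD.
pose IE' := (fun x => x - (c + h)) @^-1` IE.
pose IN' := (fun x => x - b) @^-1` IN.
have mIE : measurable IE by exact: measurable_itv.
have mIN : measurable IN by exact: measurable_itv.
have mIE' : measurable IE' by rewrite -[IE']setTI; exact: (mS _ measurableT _ (measurable_itv _)).
have mIN' : measurable IN' by rewrite -[IN']setTI; exact: (mS _ measurableT _ (measurable_itv _)).
pose s := used_noise pre q.
have us : uniq s by exact: used_noise_uniq.
have PA JE JN : measurable JE -> measurable JN -> (P (cylinder X s (A JE JN)) =
    P (X Eta @^-1` JE) * (P (X (Nu q.1 q.2) @^-1` JN) *
    \prod_(r <- pre) P (X (Nu r.1 r.2) @^-1` I0 r)))%E.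
  move=> mJE mJN; rewrite mutually_independent_cylinder//; last first.
    by move=> k _; exact: mA.
  rewrite /s /used_noise big_cons map_cons big_cons/= -surjective_pairing eqxx.
  congr (_ * (_ * _))%E; rewrite big_map; apply: eq_big_seq => r rp.
  by rewrite -(ANu JE JN).
have divr2 x y r : r \in q :: pre -> x <= y -> x / xi r.1 <= y / xi r.1.
  by move=> /xi0 x0 xy; rewrite ler_pM2r ?invr_gt0.
have qq : q \in q :: pre by rewrite inE eqxx.
have preq r : r \in pre -> r \in q :: pre by move=> rp; rewrite inE rp orbT.
have NuS r : r \in q :: pre -> Nu r.1 r.2 \in s.
  by move=> rq; rewrite /s inE (map_f (fun r => Nu r.1 r.2)) ?orbT.
apply: (@le_trans _ _ (P (cylinder X s (A IE IN)))).
  apply: le_measure; rewrite ?inE//.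
  - apply: measurableI.
      by apply: measurable_halting_event => k _; exact: measurable_funPT.
    rewrite (_ : [set w | _] = X Eta @^-1` IE); first exact: measurable_funPTI.
    by apply/seteqP; split => w /=; rewrite /IE /= in_itv.
  - by apply: measurable_cylinder => k _; exact: mA.
  - move=> w [[Hpre Hq] /= /andP[aE Eh]] k.
    rewrite /s /used_noise inE => /predU1P[->|].
      by rewrite /= /IE /= in_itv/= aE.
    move=> /mapP[r]; rewrite inE => /predU1P[->|rp] ->.
      rewrite /= -surjective_pairing eqxx /IN/= in_itv/= andbT.
      have := divr2 _ _ _ qq aE; lra.
    rewrite ANu// /I0/= in_itv/=.
    have := divr2 _ _ _ (preq _ rp) (ltW Eh); have := Hpre _ rp; lra.
(* Only two factors of the product change: a shift [c + h] at scale 2 and a shift [b] at scale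
   [4 / xi q.1], each costing [expR ((c + h) / 2)]. *)
apply: (@le_trans _ _ ((expR (c + h))%:E * P (cylinder X s (A IE' IN'))))%E.
  rewrite !PA//.
  have LEs : (P (X Eta @^-1` IE) <=
      (expR ((c + h) / 2))%:E * P (X Eta @^-1` IE'))%E.
    by apply: laplace_shift_le => //; rewrite addr_ge0.
  have LNs : (P (X (Nu q.1 q.2) @^-1` IN) <=
      (expR ((c + h) / 2))%:E * P (X (Nu q.1 q.2) @^-1` IN'))%E.
    have -> : (c + h) / 2 = b / (4 / xi q.1).
      by rewrite /b; field; rewrite gt_eqF.
    apply: laplace_shift_le => //; first by rewrite divr_gt0.
    by rewrite divr_ge0 ?mulr_ge0 ?addr_ge0// ltW.
  have -> : expR (c + h) = expR ((c + h) / 2) * expR ((c + h) / 2).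
    by rewrite -expRD; congr expR; field.
  rewrite EFinM muleACA.
  have pr0 : (0 <= \prod_(r <- pre) P (X (Nu r.1 r.2) @^-1` I0 r))%E.
    by apply: prode_ge0 => r _; exact: measure_ge0.
  apply: lee_pmul => //; first exact: mule_ge0.
  by rewrite muleA lee_wpmul2r.
rewrite lee_wpmul2l ?lee_fin ?expR_ge0//.
apply: le_measure; rewrite ?inE//.
- by apply: measurable_cylinder => k _; exact: mA.
- apply: measurableI.
    by apply: measurable_halting_event => k _; exact: measurable_funPT.
  rewrite (_ : [set w | _] = X Eta @^-1` IE'); first exact: measurable_funPTI.
  by apply/seteqP; split => w /=; rewrite /IE' /IE /= in_itv.
- move=> w Aw.
  have := Aw Eta; rewrite /s inE eqxx => /(_ isT).
  rewrite /= /IE' /IE /= in_itv/= => aEh; split => //; have /andP[aE Eh] := aEh.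
  split => [r rp|].
    have := Aw _ (NuS _ (preq _ rp)); rewrite ANu// /I0/= in_itv/=.
    (* Of the shift [c + h], the part [h] reaches the upper end of the cell, at which [I0] is
       defined, and [c] absorbs the change of the answer. *)
    have aE' : a + h + c <= X Eta w by lra.
    have := divr2 _ _ _ (preq _ rp) aE'; rewrite mulrDl.
    by have := gg' _ (preq _ rp); rewrite ler_norml => /andP[]; lra.
  have := Aw _ (NuS _ qq); rewrite /= -surjective_pairing eqxx.
  rewrite /IN' /IN/= in_itv/= andbT /b.
  have Eh' : X Eta w <= a + 2 * (c + h) - c by lra.
  have := divr2 _ _ _ qq Eh'; rewrite 2!mulrDl mulNr.
  by have := gg' _ qq; rewrite ler_norml => /andP[]; lra.
Qed.

Lemma halting_event_le (R : realType) (d : measure_display)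
    (Omega : measurableType d) (P : probability Omega R)
    (X : noise_index -> {RV P >-> R}) (T : R) (xi : nat -> R)
    (pre : seq (nat * nat)) (q : nat * nat) (g g' : nat * nat -> R) (c : R) :
  mutually_independent X -> laplace_distributed (X Eta) 2 ->
  laplace_distributed (X (Nu q.1 q.2)) (4 / xi q.1) ->
  uniq (q :: pre) -> {in q :: pre, forall r, 0 < xi r.1} ->
  {in q :: pre, forall r, `|g r - g' r| <= c / xi r.1} -> 0 <= c ->
  (P (halting_event X T xi pre q g) <=
   (expR c)%:E * P (halting_event X T xi pre q g'))%E.
Proof.
move=> indX LE LN uq xi0 gg' c0.
have mH g0 : measurable (halting_event X T xi pre q g0).
  by apply: measurable_halting_event => k _; exact: measurable_funPT.
have fH g0 : P (halting_event X T xi pre q g0) \is a fin_num.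
  exact: fin_num_measure.
rewrite -[leLHS]fineK// -[X in (_ * X)%E]fineK// -EFinM lee_fin.
apply: le_expR_gt0P; first exact/fine_ge0/measure_ge0.
move=> h h0; rewrite -lee_fin EFinM !fineK//.
(* The cells of [X Eta - s] are indexed by integers, encoded as naturals by [pickle]; a natural that
   encodes no integer has an empty cell. *)
pose N (s : R) w := pickle (Num.floor ((X Eta w - s) / h)).
have NE s z : N s @^-1` [set pickle z] =
    [set w | z%:~R * h <= X Eta w - s < z%:~R * h + h].
  have cellE w : (Num.floor ((X Eta w - s) / h) == z) =
      (z%:~R * h <= X Eta w - s < z%:~R * h + h).
    by rewrite floor_eq ler_pdivlMr// ltr_pdivrMr// intrD mulrDl mul1r.
  apply/seteqP; split => w /=; rewrite -cellE.
    by move=> /(pcan_inj pickleK)/eqP.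
  by move=> /eqP; rewrite /N => ->.
have N0 s n : ~ (exists z : int, pickle z = n) -> N s @^-1` [set n] = set0.
  by move=> nz; apply/seteqP; split => w //= Nw; apply: nz; eexists; exact: Nw.
have mN s n : measurable (N s @^-1` [set n]).
  have [[z <-]|/N0->//] := pselect (exists z : int, pickle z = n).
  rewrite NE (_ : [set w | _] =
    X Eta @^-1` `[z%:~R * h + s, z%:~R * h + s + h[%classic).
    by apply: measurable_funPTI; exact: measurable_itv.
  by apply/seteqP; split => w /=; rewrite in_itv/=; lra.
(* The offset [c + h] pairs each cell of eta with its translate in [halting_event_cell_le]. *)
apply: (@le_measure_partition_nat _ _ _ P (N 0) (N (c + h))).
- by move=> n; exact: measurableI.
- by move=> n; exact: measurableI.
- move=> n.
  have [[z <-]|/N0->] := pselect (exists z : int, pickle z = n); last first.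
    by rewrite setI0 measure0 mule_ge0// lee_fin expR_ge0.
  rewrite !NE; under [X in (P (_ `&` X) <= _)%E]eq_set do rewrite subr0.
  by apply: halting_event_cell_le => //; exact: ltW.
Qed.

(** * From runs of the algorithm to the output density *)

(** The size of [pre] is the number of bottoms in [halting_output], uniqueness serves independence,
    and the bounds make the hypotheses on [xi], [Delta] and [f] available. *)
Lemma queries_upto_split (t0 : nat) (ell : nat -> nat) (t i : nat) :
  (t0 <= t)%N -> (i < ell t)%N ->
  exists pre post : seq (nat * nat),
    [/\ queries_upto t0 ell t = pre ++ (t, i) :: post,
        size pre = (\sum_(t0 <= s < t) ell s + i)%N,
        uniq ((t, i) :: pre) &
        {in (t, i) :: pre, forall r, (t0 <= r.1 <= t)%N && (r.2 < ell r.1)%N}].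
Proof.
move=> t0t it.
pose pre := [seq (s, j) | s <- index_iota t0 t, j <- iota 0 (ell s)] ++
            [seq (t, j) | j <- iota 0 i].
pose post := [seq (t, j) | j <- iota i.+1 (ell t - i.+1)].
have QE : queries_upto t0 ell t = pre ++ (t, i) :: post.
  rewrite /queries_upto [index_iota t0 t.+1]/index_iota subSn// -addn1 iotaD.
  rewrite subnKC// allpairs_cat/= cats0 /pre -catA; congr (_ ++ _).
  by rewrite -[in LHS](subnKC it) addSnnS iotaD map_cat/= add0n.
have memQ r : r \in queries_upto t0 ell t ->
    (t0 <= r.1 <= t)%N && (r.2 < ell r.1)%N.
  move=> /allpairsPdep[s [j [+ + ->]]]/=.
  by rewrite mem_index_iota mem_iota ltnS add0n => -> /andP[_ ->].
have uQ : uniq (queries_upto t0 ell t).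
  apply: allpairs_uniq_dep; first exact: iota_uniq.
    by move=> s _; exact: iota_uniq.
  by move=> [s j] [s' j'] _ _ /= [-> ->].
exists pre, post; split => //.
- rewrite size_cat size_map size_iota size_allpairs_dep sumnE big_map.
  by congr (_ + _)%N; apply: eq_bigr => s _; rewrite size_iota.
- move: uQ; rewrite QE -cat_rcons cat_uniq => /and3P[+ _ _].
  by rewrite rcons_uniq.
- move=> r rp; apply: memQ; rewrite QE mem_cat.
  by move: rp; rewrite !inE => /orP[->|->]//; rewrite orbT.
Qed.

(** Induction on [pre]: a query above its threshold ends the run, so each [None] means a query below
    it, and the run stops at [q] before [post]. *)
Lemma natg_run_halting (R : realType) (U : finType)
    (D : forall t : nat, t.-tuple U) (f : forall t : nat, nat -> t.-tuple U -> R)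
    (T : R) (xi : nat -> R) (z : noise_index -> R)
    (pre post : seq (nat * nat)) (q : nat * nat) (v : R) :
  natg_run D f T xi z (pre ++ q :: post) =
    rcons (nseq (size pre) None) (Some v) <->
  ({in pre, forall r,
     f r.1 r.2 (D r.1) + z (Nu r.1 r.2) < T + z Eta / xi r.1} /\
   T + z Eta / xi q.1 <= f q.1 q.2 (D q.1) + z (Nu q.1 q.2)) /\
  f q.1 q.2 (D q.1) + z (Zed q.1 q.2) = v.
Proof.
elim: pre => [|[t i] pre IHpre] /=.
  case: q => t i /=; case: leP => [le_T|lt_T].
    by split => [[->]//|[_ ->]//].
  by split => [//|[[_]]].
case: leP => [le_T|lt_T].
  split => [//|[[Hpre _] _]].
  by have := Hpre (t, i); rewrite inE eqxx => /(_ isT) /=; rewrite ltNge le_T.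
split.
  move=> [] /IHpre[[Hpre Hq] Hv]; do 2 split => //.
  by move=> r; rewrite inE => /predU1P[->//|]; exact: Hpre.
move=> [[Hpre Hq] Hv]; congr cons; apply/IHpre; do 2 split => //.
by move=> r rp; apply: Hpre; rewrite inE rp orbT.
Qed.

Lemma natg_halts_inE (R : realType) (U : finType) (d : measure_display)
    (Omega : measurableType d) (P : probability Omega R)
    (t0 : nat) (ell : nat -> nat) (D : forall t : nat, t.-tuple U)
    (f : forall t : nat, nat -> t.-tuple U -> R) (T : R) (xi : nat -> R)
    (X : noise_index -> {RV P >-> R}) (t i : nat)
    (pre post : seq (nat * nat)) (B : set R) :
  queries_upto t0 ell t = pre ++ (t, i) :: post ->
  size pre = (\sum_(t0 <= s < t) ell s + i)%N ->
  natg_halts_in t0 ell D f T xi X t i B =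
  halting_event X T xi pre (t, i) (fun r => f r.1 r.2 (D r.1)) `&`
  X (Zed t i) @^-1` ((fun z => z + f t i (D t)) @^-1` B).
Proof.
move=> QE sz; rewrite /natg_halts_in /halting_output QE -sz.
apply/seteqP; split => [w [v Bv /natg_run_halting[Hw vE]]|w [Hw Bw]].
  by split => //; rewrite /= addrC vE.
by eexists; [exact: Bw|apply/natg_run_halting; split => //=; rewrite addrC].
Qed.

Lemma halting_natg_density (R : realType) (U : finType) (d : measure_display)
    (Omega : measurableType d) (P : probability Omega R)
    (t0 : nat) (ell : nat -> nat) (D : forall t : nat, t.-tuple U)
    (f : forall t : nat, nat -> t.-tuple U -> R) (T : R) (xi : nat -> R)
    (X : noise_index -> {RV P >-> R}) (t i : nat)
    (pre post : seq (nat * nat)) (b : R) :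
  queries_upto t0 ell t = pre ++ (t, i) :: post ->
  size pre = (\sum_(t0 <= s < t) ell s + i)%N -> uniq ((t, i) :: pre) ->
  mutually_independent X -> 0 < b -> laplace_distributed (X (Zed t i)) b ->
  natg_density t0 ell D f T xi X t i (fun v =>
    fine (P (halting_event X T xi pre (t, i) (fun r => f r.1 r.2 (D r.1)))) *
    laplace_pdf b (v - f t i (D t))).
Proof.
move=> QE sz uq indX b0 LZ.
set g := fun r : nat * nat => _.
set H := halting_event _ _ _ _ _ _.
have cL : continuous (fun v => laplace_pdf b (v - f t i (D t))).
  move=> v; apply: (continuous_comp (f := fun v : R => v - f t i (D t))).
    by apply: cvgB; [exact: cvg_id|exact: cvg_cst].
  exact: continuous_laplace_pdf.
have mH : measurable H.
  by apply: measurable_halting_event => k _; exact: measurable_funPT.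
have fPH : P H \is a fin_num by exact: fin_num_measure.
have PH0 : 0 <= fine (P H) by exact/fine_ge0/measure_ge0.
split.
- by move=> v; apply: cvgM; [exact: cvg_cst|exact: cL].
- by move=> v; rewrite mulr_ge0// laplace_pdf_ge0.
move=> B mB.
have mB' : measurable ((fun z : R => z + f t i (D t)) @^-1` B).
  have mS : measurable_fun [set: R] (fun z : R => z + f t i (D t)).
    exact: measurable_funD.
  by rewrite -[X in measurable X]setTI; exact: mS.
rewrite (natg_halts_inE _ _ _ _ _ _ QE sz) -/g -/H.
rewrite (@mutually_independent_sigma _ _ _ P _ X (used_noise pre (t, i)))//.
- have mL (A : set R) :
      measurable_fun A (fun v => (laplace_pdf b (v - f t i (D t)))%:E).
    apply/measurable_EFinP; apply: measurable_funTS.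
    exact: continuous_measurable_fun.
  have L0 v : (0 <= (laplace_pdf b (v - f t i (D t)))%:E)%E.
    by rewrite lee_fin laplace_pdf_ge0.
  rewrite (LZ _ mB').
  transitivity (P H * \int[lebesgue_measure]_(v in B)
      (laplace_pdf b (v - f t i (D t)))%:E)%E.
    congr (_ * _)%E; rewrite -(ge0_integral_preimage_addr (f t i (D t)) mB)//.
    by apply: eq_integral => z _; rewrite addrK.
  rewrite -[P H]fineK// -ge0_integralZl ?lee_fin//.
  exact: mL.
- rewrite cons_uniq used_noise_uniq// andbT; apply/negP.
  by rewrite inE => /predU1P[//|/mapP[]].
- set G := [set cylinder _ _ _ | _ in _].
  (* The draws are read over the sigma-algebra generated by the cylinders. Each one in [used_noise]
     is measurable there, its preimages being cylinders with one constrained coordinate, hence so is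
     the event. *)
  pose Y k : g_sigma_algebraType G -> R := X k.
  suff : measurable (halting_event Y T xi pre (t, i) g) by [].
  apply: measurable_halting_event => k ks _ A mA; rewrite setTI.
  apply: sub_sigma_algebra.
  exists (fun j => if j == k then A else setT).
    by move=> j; case: ifP.
  apply/seteqP; split => [w /(_ _ ks)|w Aw j _]; first by rewrite eqxx.
  by case: eqP => [->|].
Qed.

(** * Sensitivity and the final estimate *)

Lemma le_sensitivity (R : realType) (U : finType) (t : nat)
    (g : t.-tuple U -> R) (E E' : t.-tuple U) :
  neighboring E E' -> `|g E - g E'| <= sensitivity g.
Proof.
move=> EE'; exact: (@le_bigmax_cond _ _ _ _ (E, E') _
  (fun p : t.-tuple U * t.-tuple U => `|g p.1 - g p.2|)).
Qed.

Theorem theorem33 (R : realType) (U : finType)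
    (d : measure_display) (Omega : measurableType d) (P : probability Omega R)
    (t0 : nat) (xi Delta : nat -> R)
    (xi_gt0 : forall t : nat, (t0 <= t)%N -> 0 < xi t)
    (Delta_gt0 : forall t : nat, (t0 <= t)%N -> 0 < Delta t)
    (Delta_noninc : forall s t : nat, (t0 <= s <= t)%N -> Delta t <= Delta s)
    (xiDelta_noninc : forall s t : nat, (t0 <= s <= t)%N ->
       xi t * Delta t <= xi s * Delta s)
    (xi_nondec : forall s t : nat, (t0 <= s <= t)%N -> xi s <= xi t)
    (ell : nat -> nat) (f : forall t : nat, nat -> t.-tuple U -> R)
    (f_sens : forall t i : nat, (t0 <= t)%N -> (i < ell t)%N ->
       sensitivity (f t i) <= Delta t)
    (T : R)
    (noise : noise_index -> {RV P >-> R})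
    (noiseP : natg_noise t0 ell xi noise)
    (t' i' : nat) (t'_ge : (t0 <= t')%N) (i'_lt : (i' < ell t')%N)
    (D D' : forall t : nat, t.-tuple U)
    (D_stream : database_stream t0 D) (D'_stream : database_stream t0 D')
    (DD' : neighboring_streams t0 D D') :
  exists p p' : R -> R,
    [/\ natg_density t0 ell D f T xi noise t' i' p,
        natg_density t0 ell D' f T xi noise t' i' p' &
        forall v : R,
          p v <= expR (xi t0 * Delta t0 + xi t' * Delta t' / 8) * p' v].
Proof.
have [indX LE LN LZ] := noiseP.
have [pre [post [QE sz uq memq]]] := queries_upto_split t'_ge i'_lt.
have fDD' r : (t0 <= r.1)%N -> (r.2 < ell r.1)%N ->
    `|f r.1 r.2 (D r.1) - f r.1 r.2 (D' r.1)| <= Delta r.1.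
  move=> t0r ir; have [t [_ DE DN]] := DD'.
  (* Before time [t] the databases coincide; from [t] on they are neighboring and the sensitivity
     bound applies. *)
  have [rt|tr] := ltnP r.1 t.
    by rewrite DE ?t0r// subrr normr0 ltW// Delta_gt0.
  by apply: le_trans (f_sens _ _ t0r ir); apply: le_sensitivity; exact: DN.
have x0 : 0 < xi t' by exact: xi_gt0.
have b0 : 0 < 8 / xi t' by rewrite divr_gt0.
have dens D0 := halting_natg_density D0 f T xi QE sz uq indX b0
  (LZ _ _ t'_ge i'_lt).
do 2 eexists; split; [exact: dens|exact: dens|move=> v /=].
set H := halting_event _ _ _ _ _ _; set H' := halting_event _ _ _ _ _ _.
have fH g : P (halting_event noise T xi pre (t', i') g) \is a fin_num.
  apply: fin_num_measure; apply: measurable_halting_event => k _.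
  exact: measurable_funPT.
have HH' : fine (P H) <= expR (xi t0 * Delta t0) * fine (P H').
  rewrite -lee_fin EFinM !fineK ?fH//.
  apply: (@halting_event_le _ _ _ P noise) => //.
  - exact: LN.
  - by move=> r /memq/andP[/andP[t0r _] _]; exact: xi_gt0.
  (* [Delta r.1] is at most [c / xi r.1] for [c = xi t0 * Delta t0], because [xi * Delta] is
     non-increasing. *)
  - move=> r /memq/andP[/andP[t0r _] ir]; apply: le_trans (fDD' _ t0r ir) _.
    by rewrite ler_pdivlMr ?xi_gt0// mulrC xiDelta_noninc// leqnn.
  - by rewrite mulr_ge0// ltW// ?xi_gt0 ?Delta_gt0.
rewrite expRD mulrACA; apply: ler_pM => //.
- exact/fine_ge0/measure_ge0.
- exact: laplace_pdf_ge0.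
(* The remaining exponent is the shift [Delta t'] of the released value divided by its noise
   scale. *)
- have -> : xi t' * Delta t' / 8 = Delta t' / (8 / xi t').
    by field; rewrite gt_eqF.
  apply: laplace_pdf_shift_le => //.
  have := fDD' (t', i') t'_ge i'_lt; rewrite /= distrC; congr (`|_| <= _); ring.
Qed.
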